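(* Let $N$ agents of the form $$\dot x_{j,i}=x_{j+1,i}\ (1\le j\le n_i-1),\qquad \dot x_{n_i,i}=\theta_i^{\mathrm T}\boldsymbol p_i(x_i,t)+u_i,\qquad y_i=x_{1,i},\qquad i=1,\dots,N,$$ be given, where the basis vectors $\boldsymbol p_i$ are known, and satisfy $\|\boldsymbol p_i(x_i,t)\|\le\rho_i(x_i)$ for all $x_i\in\mathbb R^{n_i}$, $t\ge0$ with some smooth function $\rho_i$, and the constant parameter vectors $\theta_i\in\mathbb R^{n_{\theta_i}}$ are unknown. Suppose that each local cost $f_i:\mathbb R\to\mathbb R$ is differentiable, $\underline l$-strongly convex with $\overline l$-Lipschitz gradient for some constants $\underline l,\overline l>0$, and that the weighted undirected graph $\mathcal G$ with adjacency weights $a_{ij}$ is connected. Let $y^*=\arg\min_{y\in\mathbb R}\sum_{i=1}^N f_i(y)$. Let the gains $k_{ji}$ and the matrices $P_i$ be as defined in the context. Then there exists $\varepsilon^*>0$, not depending on the unknown $\theta_i$ or on the initial conditions, such that for every $\varepsilon\in(0,\varepsilon^* )$ the distributed controller $$\begin{aligned} u_i&=-\hat\theta_i^{\mathrm T}\boldsymbol p_i(x_i,t)+\frac1{\varepsilon^{n_i}}\Big[k_{1i}(x_{1,i}-r_i)+\sum_{j=2}^{n_i}\varepsilon^{j-1}k_{ji}x_{j,i}\Big],\\ \dot{\hat\theta}_i&=\boldsymbol p_i(x_i,t)\,b_{2i}^{\mathrm T}P_i\hat x_i,\\ \dot r_i&=-\nabla f_i(y_i)-\sum_{j=1}^N a_{ij}(\lambda_i-\lambda_j),\\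 \dot\lambda_i&=\sum_{j=1}^N a_{ij}(r_i-r_j), \end{aligned}\qquad i=1,\dots,N,$$ where $\hat x_i=\mathrm{col}(x_{1,i}-r_i,\ \varepsilon x_{2,i},\dots,\varepsilon^{n_i-1}x_{n_i,i})$, solves the distributed optimization problem: for every choice of initial conditions of the closed-loop system, (1) all the agents' trajectories $x_i(t)$ are bounded over $[0,+\infty)$, and (2) $\lim_{t\to+\infty}|y_i(t)-y^*|=0$ for $i=1,\dots,N$.
   Context: Agents: $x_{j,i}\in\mathbb R$, $x_i=\mathrm{col}(x_{1,i},\dots,x_{n_i,i})\in\mathbb R^{n_i}$, $u_i,y_i\in\mathbb R$ are the state, input and output of agent $i$; orders $n_i$ may differ between agents. $\mathrm{col}(\cdot)$ denotes stacking into a column vector. $\boldsymbol p_i(x_i,t)\in\mathbb R^{n_{\theta_i}}$. Graph: $\mathcal G$ is a weighted undirected graph on nodes $\{1,\dots,N\}$ with weights $a_{ij}=a_{ji}\ge0$, $a_{ii}=0$, and $a_{ij}>0$ if and only if $i$ and $j$ are joined by an edge. Connected means there is a path between any two nodes. The minimizer $y^*$ exists and is unique, and is finite. Gains: for each $i$, $k_{1i},\dots,k_{n_i i}$ are real constants such that the polynomial $s^{n_i}-k_{n_i i}s^{n_i-1}-\cdots-k_{2i}s-k_{1i}$ is Hurwitz (all roots have negative real part). $A_i\in\mathbb R^{n_i\times n_i}$ is the companion matrix whose first $n_i-1$ rows are $[\,0\mid I_{n_i-1}\,]$ and whose last row is $[k_{1i},k_{2i},\dots,k_{n_i i}]$.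 $P_i$ is the unique positive definite solution of $A_i^{\mathrm T}P_i+P_iA_i=-2I_{n_i}$. $b_{2i}=\mathrm{col}(0,\dots,0,1)\in\mathbb R^{n_i}$. The variables $\hat\theta_i\in\mathbb R^{n_{\theta_i}}$, $r_i,\lambda_i\in\mathbb R$ are the controller states. The closed-loop system consists of the agents together with the controller, with states $x_i,\hat\theta_i,r_i,\lambda_i$, $i=1,\dots,N$. *)

(* Defs.v *)
From HB Require Import structures.
From mathcomp Require Import all_boot all_order all_algebra.
From mathcomp Require Import all_classical all_reals all_analysis.
From mathcomp Require Import complex.

Set Implicit Arguments.
Unset Strict Implicit.
Unset Printing Implicit Defensive.

Import Order.TTheory GRing.Theory Num.Theory.
Import numFieldNormedType.Exports.

Local Open Scope classical_set_scope.
Local Open Scope ring_scope.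

(* The library norm on matrices is the max norm, hence this definition. *)
Definition enorm (R : realType) (n : nat) (v : 'cV[R]_n) : R :=
  Num.sqrt (\sum_j v j 0 ^+ 2).

Fixpoint partials (R : realType) (n : nat) (s : seq 'I_n) (f : 'cV[R]_n -> R)
    : 'cV[R]_n -> R :=
  if s is j :: s' then fun x => 'D_(delta_mx j 0) (partials s' f) x else f.

(* C^oo: partial derivatives of all orders exist and are continuous. *)
Definition smooth (R : realType) (n : nat) (f : 'cV[R]_n -> R) : Prop :=
  forall s : seq 'I_n, continuous (partials s f) /\
    forall (j : 'I_n) (x : 'cV[R]_n), derivable (partials s f) x (delta_mx j 0).

Definition strongly_convex (R : realType) (l : R) (f : R -> R) : Prop :=
  forall x y t : R, 0 <= t <= 1 ->
    f (t * x + (1 - t) * y) <=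
      t * f x + (1 - t) * f y - l / 2 * (t * (1 - t)) * (x - y) ^+ 2.

Definition is_argmin (R : realType) (F : R -> R) (y : R) : Prop :=
  forall z, F y <= F z.

Definition weighted_graph (R : realType) (N : nat) (a : 'M[R]_N) : Prop :=
  [/\ forall i j, a i j = a j i, forall i j, 0 <= a i j & forall i, a i i = 0].

Definition graph_connected (R : realType) (N : nat) (a : 'M[R]_N) : Prop :=
  forall i j, connect [rel v w | 0 < a v w] i j.

(* All roots are taken among the complex numbers R[i]. *)
Definition hurwitz (R : realType) (q : {poly R}) : Prop :=
  forall z : R[i], root (map_poly (real_complex R) q) z -> complex.Re z < 0.

(* Coordinates are numbered from 0, so [k j] is the gain k_{j+1}. *)
Definition gain_poly (R : realType) (n : nat) (k : 'I_n -> R) : {poly R} :=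
  'X^n - \sum_(j < n) k j *: 'X^j.

Definition companion_mx (R : realType) (n : nat) (k : 'I_n -> R) : 'M[R]_n :=
  \matrix_(i, j) if i.+1 == n then k j else (j == i.+1 :> nat)%:R.

Definition posdef (R : realType) (n : nat) (P : 'M[R]_n) : Prop :=
  P^T = P /\ forall v : 'cV[R]_n, v != 0 -> 0 < (v^T *m P *m v) 0 0.

Definition lyapunov_solution (R : realType) (n : nat) (k : 'I_n -> R)
    (P : 'M[R]_n) : Prop :=
  posdef P /\
  (companion_mx k)^T *m P + P *m companion_mx k = - 2%:R *: 1%:M.

Definition b2 (R : realType) (n : nat) : 'cV[R]_n :=
  \col_j (j.+1 == n)%:R.

Definition output (R : realType) (n : nat) (hn : (0 < n)%N) (x : 'cV[R]_n) : R :=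
  x (Ordinal hn) 0.

Definition scaled_state (R : realType) (n : nat) (eps r : R) (x : 'cV[R]_n)
    : 'cV[R]_n :=
  \col_j if j == 0 :> nat then x j 0 - r else eps ^+ j * x j 0.

Definition control_input (R : realType) (n m : nat) (hn : (0 < n)%N)
    (k : 'I_n -> R) (eps : R) (pval th : 'cV[R]_m) (r : R) (x : 'cV[R]_n) : R :=
  - (th^T *m pval) 0 0 +
  1 / eps ^+ n *
    (k (Ordinal hn) * (x (Ordinal hn) 0 - r) +
     \sum_(j < n | (0 < j)%N) eps ^+ j * k j * x j 0).

(* [z' = dz] on [0, T[.  At the left end point only continuity of [z] is
   required: this is implied by right differentiability.  [T] may be finite, so
   that a solution is not presupposed to be global: a bound on every [0, T[
   rules out finite escape. *)
Definition ode_on (R : realType) (V : normedModType R) (T : \bar R)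
    (z dz : R -> V) : Prop :=
  (z t @[t --> 0^'+] --> z 0) /\
  forall t : R, 0 < t -> (t%:E < T)%E -> is_derive t 1 z (dz t).

Definition agent_solution (R : realType) (n m : nat)
    (p : 'cV[R]_n -> R -> 'cV[R]_m) (theta : 'cV[R]_m) (T : \bar R)
    (u : R -> R) (x : R -> 'cV[R]_n) : Prop :=
  (forall j j' : 'I_n, j' = j.+1 :> nat ->
     ode_on T (fun t => x t j 0 : R^o) (fun t => x t j' 0)) /\
  (forall j : 'I_n, j.+1 = n ->
     ode_on T (fun t => x t j 0 : R^o)
       (fun t => (theta^T *m p (x t) t) 0 0 + u t)).

(* [theta] holds the true parameters, [th] their estimates. *)
Definition closed_loop_solution (R : realType) (N : nat) (n m : 'I_N -> nat)
    (hn : forall i, (0 < n i)%N)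
    (p : forall i, 'cV[R]_(n i) -> R -> 'cV[R]_(m i))
    (f : 'I_N -> R -> R) (a : 'M[R]_N)
    (k : forall i, 'I_(n i) -> R) (P : forall i, 'M[R]_(n i))
    (theta : forall i, 'cV[R]_(m i)) (eps : R) (T : \bar R)
    (x : forall i, R -> 'cV[R]_(n i)) (th : forall i, R -> 'cV[R]_(m i))
    (r lam : 'I_N -> R -> R) : Prop :=
  forall i : 'I_N,
  [/\ agent_solution (p i) (theta i) T
        (fun t => control_input (hn i) (k i) eps (p i (x i t) t) (th i t)
                    (r i t) (x i t)) (x i),
      ode_on T (th i)
        (fun t => ((b2 R (n i))^T *m P i *m
                     scaled_state eps (r i t) (x i t)) 0 0 *: p i (x i t) t),
      ode_on T (r i : R -> R^o)
        (fun t => - derive1 (f i) (output (hn i) (x i t))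
                  - \sum_(j < N) a i j * (lam i t - lam j t)) &
      ode_on T (lam i : R -> R^o)
        (fun t => \sum_(j < N) a i j * (r i t - r j t))].

(* Main.v *)
Require Import Defs.
From mathcomp Require Import all_boot all_order all_algebra.
From mathcomp Require Import all_classical all_reals all_analysis.
From mathcomp Require Import ring lra.
Import Order.TTheory GRing.Theory Num.Theory.
Import numFieldNormedType.Exports.
Local Open Scope classical_set_scope.
Local Open Scope ring_scope.

(** The closed loop is a fast tracking system driven by a slow saddle-point
flow, and one quadratic Lyapunov function covers both.

Let [L] be the Laplacian of the graph.  The sum of the gradients vanishes at
[ystar] ([sum_derive_argmin]) and the range of [L] is the orthogonal of the
constants ([laplacian_range]), so there is [lamstar] with
[L lamstar = - col (f_i' ystar)].  With [e = r - ystar], [eta = lam - lamstar]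
and [g_i = f_i' y_i - f_i' ystar] the reference part reads
[e' = - (g + L eta)], [eta' = L e].

In the scaled coordinates [xi_i] each agent reads
[eps xi_i' = A_i xi_i + eps^n_i (mismatch . p_i) b2 - eps r_i' b1], where
[b1] is the first basis vector and [mismatch = theta_i - th_i]
([ode_on_scaled_state]).  The update law is chosen
so that in the derivative of
[storage_i = xi_i . P_i xi_i + eps^(n_i - 1) |mismatch|^2] the unknown
parameters cancel: it is
[- (2 / eps) |xi_i|^2 - 2 r_i' (P_i xi_i)_0] ([ode_on_storage]).  This is why
the bound on [eps] depends neither on [theta] nor on the initial state.

The Lyapunov function is
[|e|^2 / 2 + |eta|^2 / 2 + d e . L eta + sum_i storage_i].  The first two terms
alone dissipate only the output error; the cross term, with small [d], adds
[- d |L eta|^2], which is what is needed to absorb the [L eta] contained in the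
disturbance [r_i'] of the fast part.  All the remaining cross terms are paid
for by [(2 / eps) |xi|^2] once [eps] is small, leaving the rate
[- (l / 4) sum_i (y_i - ystar)^2] ([agent_dissipation], [lyapunov_rate_le]).

Hence the Lyapunov function bounds all the signals on the whole interval of
existence; in particular the states are bounded ([bounded_enorm]).  The bound
on [p_i] then makes each output Lipschitz in time, and a nonnegative function
that decreases at least at the rate [c q^2], with [q] Lipschitz, forces [q] to
vanish at infinity ([dissipation_vanishes], [output_converges]). *)

Set Implicit Arguments.
Unset Strict Implicit.
Unset Printing Implicit Defensive.

(** * Calculus of solutions *)

Section OdeCalculus.
Context {R : realType} (T : \bar R).
Implicit Types (z w dz dw : R -> R^o).

Lemma ode_on_ext z w dz dw : z =1 w ->
  (forall t, 0 < t -> (t%:E < T)%E -> dz t = dw t) ->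
  ode_on T z dz -> ode_on T w dw.
Proof.
move=> /funext <- e [z0 dzP]; split=> // t t0 tT.
by rewrite -e//; exact: dzP.
Qed.

Lemma ode_on_cst (c : R) : ode_on T (fun=> c : R^o) (fun=> 0).
Proof. by split=> [|t _ _]; [exact: cvg_cst|exact: is_derive_cst]. Qed.

Lemma ode_onD z w dz dw : ode_on T z dz -> ode_on T w dw ->
  ode_on T (fun t => z t + w t) (fun t => dz t + dw t).
Proof.
move=> [z0 dzP] [w0 dwP]; split=> [|t t0 tT]; first exact: cvgD.
by apply: is_deriveD; [exact: dzP|exact: dwP].
Qed.

Lemma ode_onM z w dz dw : ode_on T z dz -> ode_on T w dw ->
  ode_on T (fun t => z t * w t : R^o) (fun t => dz t * w t + z t * dw t).
Proof.
move=> [z0 dzP] [w0 dwP]; split=> [|t t0 tT]; first exact: cvgM.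
have := is_deriveM (dzP t t0 tT) (dwP t t0 tT).
by rewrite addrC [w t *: _]mulrC.
Qed.

Lemma ode_onZ (c : R) z dz : ode_on T z dz ->
  ode_on T (fun t => c * z t : R^o) (fun t => c * dz t).
Proof.
move=> zP; have := ode_onM (ode_on_cst c) zP.
by apply: ode_on_ext => // t _ _; rewrite mul0r add0r.
Qed.

Lemma ode_on_sum (I : Type) (s : seq I) (z dz : I -> R -> R^o) :
  (forall i, ode_on T (z i) (dz i)) ->
  ode_on T (fun t => \sum_(i <- s) z i t) (fun t => \sum_(i <- s) dz i t).
Proof.
move=> zP; elim: s => [|i s ih].
  by apply: ode_on_ext (ode_on_cst 0) => t *; rewrite big_nil.
by apply: ode_on_ext (ode_onD (zP i) ih) => t *; rewrite big_cons.
Qed.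

(** Passing to coordinates lets the scalar rules serve the vector-valued
    states. *)
Lemma ode_on_coord (n : nat) (z dz : R -> 'cV[R]_n) (j : 'I_n) :
  ode_on T z dz -> ode_on T (fun t => z t j 0 : R^o) (fun t => dz t j 0).
Proof.
move=> [z0 dzP]; split=> [|t t0 tT].
  exact: (cvg_comp _ _ z0 (@coord_continuous R n 1 j 0 (z 0))).
have [dv <-] := dzP t t0 tT; split; first exact: (derivable_mxP _ _ _).1.
by rewrite derive_mx// mxE.
Qed.

Lemma ode_on_within z dz (s t : R) : ode_on T z dz ->
  0 <= s -> s < t -> (t%:E < T)%E -> {within `[s, t], continuous z}.
Proof.
move=> [z0 dzP] s0 st tT.
have ct u : 0 < u -> (u%:E < T)%E -> {for u, continuous z}.
  move=> u0 uT; apply/differentiable_continuous/derivable1_diffP.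
  by case: (dzP u u0 uT).
apply/continuous_within_itvP => //; split.
- move=> u; rewrite in_itv/= => /andP[su ut]; apply: ct; first exact: le_lt_trans su.
  by apply: lt_trans tT; rewrite lte_fin.
- move: s0; rewrite le_eqVlt => /predU1P[<-//|s0].
  apply: cvg_at_right_filter; apply: ct => //.
  by apply: lt_trans tT; rewrite lte_fin.
- by apply: cvg_at_left_filter; apply: ct => //; exact: le_lt_trans st.
Qed.

(** [dz] is meaningful only at positive times, hence the alternative: the
    intermediate point can be [0] only when the interval is a point. *)
Lemma ode_on_MVT z dz (s t : R) : ode_on T z dz ->
  0 <= s -> s <= t -> (t%:E < T)%E ->
  exists2 c, s <= c <= t /\ (0 < c \/ s = t) & z t - z s = dz c * (t - s).
Proof.
move=> zP s0; rewrite le_eqVlt => /predU1P[->|st] tT.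
  by exists t; [rewrite lexx; split=> //; right|rewrite !subrr mulr0].
have zd u : u \in `]s, t[%R -> is_derive u 1 z (dz u).
  rewrite in_itv/= => /andP[su ut]; apply: zP.2.
    exact: le_lt_trans su.
  by apply: lt_trans tT; rewrite lte_fin.
have [c cst e] := MVT st zd (ode_on_within zP s0 st tT).
move: cst; rewrite in_itv/= => /andP[sc ct]; exists c => //.
by rewrite !ltW//; split=> //; left; exact: le_lt_trans sc.
Qed.

End OdeCalculus.

(** * Quadratic forms *)

Section Dot.
Context {R : realType}.

Definition dot (n : nat) (u v : 'cV[R]_n) : R := (u^T *m v) 0 0.

Lemma dotE n (u v : 'cV[R]_n) : dot u v = \sum_j u j 0 * v j 0.
Proof. by rewrite /dot mxE; apply: eq_bigr => j _; rewrite mxE. Qed.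

Lemma dotC n (u v : 'cV[R]_n) : dot u v = dot v u.
Proof. by rewrite !dotE; apply: eq_bigr => j _; rewrite mulrC. Qed.

Lemma dotDl n (u v w : 'cV[R]_n) : dot (u + v) w = dot u w + dot v w.
Proof. by rewrite /dot linearD /= mulmxDl mxE. Qed.

Lemma dotZl n c (u v : 'cV[R]_n) : dot (c *: u) v = c * dot u v.
Proof. by rewrite /dot linearZ /= -scalemxAl mxE. Qed.

Lemma dotDr n (u v w : 'cV[R]_n) : dot u (v + w) = dot u v + dot u w.
Proof. by rewrite ![dot u _]dotC dotDl. Qed.

Lemma dotZr n c (u v : 'cV[R]_n) : dot u (c *: v) = c * dot u v.
Proof. by rewrite ![dot u _]dotC dotZl. Qed.

Lemma dotNl n (u v : 'cV[R]_n) : dot (- u) v = - dot u v.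
Proof. by rewrite -scaleN1r dotZl mulN1r. Qed.

Lemma dotNr n (u v : 'cV[R]_n) : dot u (- v) = - dot u v.
Proof. by rewrite ![dot u _]dotC dotNl. Qed.

Lemma dot_mulmx m n (A : 'M[R]_(m, n)) u v :
  dot u (A *m v) = dot (A^T *m u) v.
Proof. by rewrite /dot trmx_mul trmxK mulmxA. Qed.

Lemma dot_delta n (u : 'cV[R]_n) j : dot (delta_mx j 0) u = u j 0.
Proof.
rewrite dotE (bigD1 j) //= mxE !eqxx mul1r big1 ?addr0 // => i ij.
by rewrite mxE (negbTE ij) mul0r.
Qed.

Lemma sqr_dot n (u : 'cV[R]_n) : dot u u = \sum_j u j 0 ^+ 2.
Proof. by rewrite dotE; apply: eq_bigr => j _; rewrite expr2. Qed.

Lemma dot_ge0 n (u : 'cV[R]_n) : 0 <= dot u u.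
Proof. by rewrite sqr_dot sumr_ge0 // => j _; exact: sqr_ge0. Qed.

Lemma sqr_coord_le_dot n (u : 'cV[R]_n) j : u j 0 ^+ 2 <= dot u u.
Proof.
rewrite sqr_dot (bigD1 j) //= lerDl sumr_ge0 // => i _; exact: sqr_ge0.
Qed.

Lemma enormE n (u : 'cV[R]_n) : enorm u = Num.sqrt (dot u u).
Proof. by rewrite sqr_dot. Qed.

Lemma posdef1 n : posdef (1%:M : 'M[R]_n).
Proof.
split=> [|v v0]; first exact: trmx1.
rewrite mulmx1 lt_neqAle dot_ge0 andbT eq_sym.
apply: contraNneq v0 => v0; apply/eqP/matrixP => j i.
rewrite (ord1 i) mxE; apply/eqP; rewrite -sqrf_eq0 eq_le sqr_ge0 andbT.
by rewrite -v0 sqr_coord_le_dot.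
Qed.

Lemma posdef_gt0 n (P : 'M[R]_n) v : posdef P -> v != 0 -> 0 < dot v (P *m v).
Proof. by move=> [_ P0] /P0; rewrite /dot mulmxA. Qed.

Lemma posdef_ge0 n (P : 'M[R]_n) v : posdef P -> 0 <= dot v (P *m v).
Proof.
move=> Pp; have [->|v0] := eqVneq v 0; first by rewrite mulmx0 /dot mulmx0 mxE.
by rewrite ltW // posdef_gt0.
Qed.

(** The form is nonnegative at [a v - b u], where [a] and [b] are its values at
    [(u, u)] and [(u, v)]; this value is [a (a c - b^2)]. *)
Lemma posdef_CauchySchwarz n (P : 'M[R]_n) u v : posdef P ->
  dot u (P *m v) ^+ 2 <= dot u (P *m u) * dot v (P *m v).
Proof.
move=> Pp; have [->|u0] := eqVneq u 0.
  by rewrite mulmx0 /dot trmx0 !mul0mx mxE expr0n mul0r.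
have a0 := posdef_gt0 Pp u0.
set a := dot u (P *m u) in a0 *; set b := dot u _; set c := dot v _.
have : 0 <= a * (a * c - b ^+ 2).
  have := posdef_ge0 (a *: v - b *: u) Pp; congr (0 <= _).
  rewrite !(mulmxDr, mulmxN, =^~ scalemxAr) !(dotDl, dotDr, dotNl, dotNr).
  rewrite !(dotZl, dotZr).
  have -> : dot v (P *m u) = b by rewrite dot_mulmx Pp.1 dotC.
  by rewrite -/a -/b -/c; ring.
by rewrite pmulr_rge0 // subr_ge0.
Qed.

Lemma CauchySchwarz n (u v : 'cV[R]_n) : dot u v ^+ 2 <= dot u u * dot v v.
Proof. by have := posdef_CauchySchwarz u v (posdef1 n); rewrite !mul1mx. Qed.

Lemma posdef_unit n (P : 'M[R]_n) : posdef P -> P \in unitmx.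
Proof.
move=> Pp; rewrite -unitmx_tr -row_free_unit -kermx_eq0; apply/eqP/row_matrixP => i.
rewrite row0; apply/eqP/negP => /negP k0.
have kP : P *m (row i (kermx P^T))^T = 0.
  by rewrite -{1}[P]trmxK -trmx_mul -row_mul mulmx_ker row0 trmx0.
have /(posdef_gt0 Pp) : (row i (kermx P^T))^T != 0.
  by apply: contra k0; rewrite -{2}[row _ _]trmxK => /eqP ->; rewrite trmx0.
by rewrite kP /dot mulmx0 mxE ltxx.
Qed.

(** Each coordinate is a linear form, hence the [P]-product with the fixed
    vector [P^-1 delta_j], and Cauchy-Schwarz for [P] applies. *)
Lemma posdef_coercive n (P : 'M[R]_n) : posdef P ->
  exists2 C : R, 0 <= C & forall (v : 'cV[R]_n) j, v j 0 ^+ 2 <= C * dot v (P *m v).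
Proof.
move=> Pp; pose w j : 'cV[R]_n := invmx P *m delta_mx j 0.
exists (\sum_j dot (w j) (P *m w j)).
  by apply: sumr_ge0 => j _; exact: posdef_ge0.
move=> v j; have -> : v j 0 = dot (w j) (P *m v).
  by rewrite dot_mulmx Pp.1 mulKVmx ?posdef_unit // dot_delta.
apply: le_trans (posdef_CauchySchwarz _ _ Pp) _.
apply: ler_wpM2r; first exact: posdef_ge0.
by rewrite (bigD1 j) //= lerDl sumr_ge0 // => i _; exact: posdef_ge0.
Qed.

Lemma mulmx_bounded m n (A : 'M[R]_(m, n)) :
  exists2 C : R, 0 <= C & forall v, dot (A *m v) (A *m v) <= C * dot v v.
Proof.
pose c i := dot (row i A)^T (row i A)^T.
exists (\sum_i c i) => [|v]; first by apply: sumr_ge0 => i _; exact: dot_ge0.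
rewrite sqr_dot mulr_suml ler_sum // => i _.
have -> : (A *m v) i 0 = dot (row i A)^T v.
  by rewrite /dot trmxK -row_mul [RHS]mxE.
exact: CauchySchwarz.
Qed.

End Dot.

Section OdeVectors.
Context {R : realType} (T : \bar R).

Lemma ode_on_mulmx m n (A : 'M[R]_(m, n)) (v dv : R -> 'cV[R]_n) :
  (forall j, ode_on T (fun t => v t j 0 : R^o) (fun t => dv t j 0)) ->
  forall i, ode_on T (fun t => (A *m v t) i 0 : R^o) (fun t => (A *m dv t) i 0).
Proof.
move=> vP i; have := ode_on_sum (index_enum 'I_n) (fun j => ode_onZ (A i j) (vP j)).
by apply: ode_on_ext => t *; rewrite mxE.
Qed.

Lemma ode_on_dot n (u v du dv : R -> 'cV[R]_n) :
  (forall j, ode_on T (fun t => u t j 0 : R^o) (fun t => du t j 0)) ->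
  (forall j, ode_on T (fun t => v t j 0 : R^o) (fun t => dv t j 0)) ->
  ode_on T (fun t => dot (u t) (v t) : R^o)
           (fun t => dot (du t) (v t) + dot (u t) (dv t)).
Proof.
move=> uP vP.
have := ode_on_sum (index_enum 'I_n) (fun j => ode_onM (uP j) (vP j)).
by apply: ode_on_ext => t *; rewrite !dotE // -big_split.
Qed.

End OdeVectors.

(** * Convex costs and the graph Laplacian *)

Section Convex.
Context {R : realType}.

(** Strong convexity bounds the difference quotient of [f] at [y] towards [x];
    let the step tend to 0. *)
Lemma strongly_convex_above_tangent (l : R) (f : R -> R) (x y : R) :
  derivable f y 1 -> strongly_convex l f ->
  derive1 f y * (x - y) <= f x - f y - l / 2 * (x - y) ^+ 2.
Proof.
move=> fd fc.
pose g t := f (y + t * (x - y)).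
have gd : is_derive (0 : R) 1 g (derive1 f y * (x - y)).
  have h1 : is_derive (0 : R) 1 (fun t : R => y + t * (x - y)) (x - y).
    have := is_deriveD (is_derive_cst y (0 : R) 1)
      (is_deriveM (is_derive_id (0 : R) 1) (is_derive_cst (x - y) (0 : R) 1)).
    by rewrite scaler0 !add0r /GRing.scale /= mulr1.
  apply: is_derive1_comp.
  rewrite mul0r addr0 derive1E; exact: derivableP.
have [dg eg] := gd.
have lim1 : h^-1 * (g h - g 0) @[h --> 0^'+] --> derive1 f y * (x - y).
  have sub : (0 : R)^'+ `=>` (0 : R)^'.
    by move=> A; apply: (@filterS _ (nbhs (0 : R))) => h + h0; apply; rewrite gt_eqF.
  have := cvg_trans (cvg_app (fun h => h^-1 *: (g (h *: 1 + 0) - g 0)) sub) dg.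
  rewrite -eg; apply: cvg_trans.
  by apply: near_eq_cvg; near=> h; rewrite /= addr0 /GRing.scale /= mulr1.
pose q h : R := f x - f y - l / 2 * ((1 - h) * (x - y) ^+ 2).
have lim2 : q h @[h --> 0^'+] --> q 0.
  apply: cvg_at_right_filter.
  apply: cvgB; first exact: cvg_cst.
  apply: cvgM; first exact: cvg_cst.
  apply: cvgM; last exact: cvg_cst.
  by apply: cvgB; [exact: cvg_cst|exact: cvg_id].
have := ler_cvg_to lim1 lim2; rewrite /q subr0 mul1r; apply.
near=> h.
have h0 : 0 < h by [].
have h1 : h <= 1 by near: h; exact: nbhs_right_le.
rewrite ler_pdivrMl // /g mul0r addr0.
have -> : y + h * (x - y) = h * x + (1 - h) * y by ring.
have := fc x y h; rewrite (ltW h0) h1 => /(_ isT).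
nra.
Unshelve. all: by end_near. Qed.

(** Sum of the tangent bounds at [x] and at [y]. *)
Lemma strongly_convex_monotone (l : R) (f : R -> R) (x y : R) :
  derivable f x 1 -> derivable f y 1 -> strongly_convex l f ->
  l * (x - y) ^+ 2 <= (x - y) * (derive1 f x - derive1 f y).
Proof.
move=> fx fy fc.
have := strongly_convex_above_tangent x fy fc.
have := strongly_convex_above_tangent y fx fc.
nra.
Qed.

Lemma sum_derive_argmin (N : nat) (f : 'I_N -> R -> R) (y : R) :
  (forall i z, derivable (f i) z 1) ->
  is_argmin (fun z => \sum_(i < N) f i z) y -> \sum_i derive1 (f i) y = 0.
Proof.
move=> fd ymin.
have dF (z : R) : is_derive z 1 (\sum_i f i) (\sum_i derive1 (f i) z).
  by apply: is_derive_sum => i; rewrite derive1E; exact: derivableP.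
have : is_derive y 1 (\sum_i f i) 0.
  apply: (@derive1_at_min _ _ (y - 1) (y + 1)).
  - by lra.
  - by move=> t _; case: (dF t).
  - by rewrite in_itv /=; apply/andP; split; lra.
  - by move=> t _; rewrite !fct_sumE; exact: ymin.
by case: (dF y) => _ <- [_ ->].
Qed.

End Convex.

Section Laplacian.
Context {R : realType} {N : nat} (a : 'M[R]_N).
Hypothesis ha : weighted_graph a.

Definition laplacian : 'M[R]_N :=
  diag_mx (\row_i \sum_j a i j) - a.

Lemma laplacian_mulE (v : 'cV[R]_N) i :
  (laplacian *m v) i 0 = \sum_j a i j * (v i 0 - v j 0).
Proof.
rewrite mulmxBl mul_diag_mx !mxE mulr_suml -sumrB.
by apply: eq_bigr => j _; rewrite mulrBr.
Qed.

Lemma laplacian_sym : laplacian^T = laplacian.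
Proof.
have [sa _ _] := ha; rewrite /laplacian linearB /= tr_diag_mx.
by congr (_ - _); apply/matrixP => i j; rewrite mxE sa.
Qed.

(** Symmetrize the double sum in the two end points of an edge. *)
Lemma dot_laplacian (v : 'cV[R]_N) :
  2 * dot v (laplacian *m v) = \sum_i \sum_j a i j * (v i 0 - v j 0) ^+ 2.
Proof.
have [sa _ _] := ha.
have e : dot v (laplacian *m v) = \sum_i \sum_j a i j * (v i 0 * (v i 0 - v j 0)).
  rewrite dotE; apply: eq_bigr => i _; rewrite laplacian_mulE mulr_sumr.
  by apply: eq_bigr => j _; rewrite mulrCA.
have e' : dot v (laplacian *m v) = \sum_i \sum_j a j i * (v j 0 * (v j 0 - v i 0)).
  by rewrite e exchange_big.
rewrite mulr2n mulrDl mul1r {1}e e' -big_split /=.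
apply: eq_bigr => i _; rewrite -big_split; apply: eq_bigr => j _ /=.
by rewrite [a j i]sa; ring.
Qed.

Hypothesis hconn : graph_connected a.

(** By [dot_laplacian] a sum of nonnegative terms vanishes, so [v] takes the
    same value at both ends of each edge. *)
Lemma laplacian_ker (v : 'cV[R]_N) i j : laplacian *m v = 0 -> v i 0 = v j 0.
Proof.
have [_ a0 _] := ha.
move=> Lv; have := dot_laplacian v; rewrite Lv /dot mulmx0 mxE mulr0 => /esym e.
have ge0 x y : 0 <= a x y * (v x 0 - v y 0) ^+ 2 by rewrite mulr_ge0 ?sqr_ge0.
have edge x y : 0 < a x y -> v x 0 = v y 0.
  move=> axy; have /eqP := e.
  rewrite psumr_eq0 => [/allP /(_ x (mem_index_enum x)) /eqP|z _]; last first.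
    by rewrite sumr_ge0.
  move=> /eqP; rewrite psumr_eq0 // => /allP /(_ y (mem_index_enum y)).
  by rewrite /= mulf_eq0 (gt_eqF axy) sqrf_eq0 subr_eq0 => /eqP.
have /connectP [s sp ->] := hconn i j.
elim: s i sp => //= x s ih i /andP[ix sp].
by rewrite (edge _ _ ix); exact: ih.
Qed.

(** By symmetry the range is the orthogonal of the kernel, and the columns of
    the cokernel matrix, being in the kernel, are constant vectors. *)
Lemma laplacian_range (g : 'cV[R]_N) : \sum_i g i 0 = 0 ->
  exists v, laplacian *m v = g.
Proof.
move=> g0; suff /submxP [w wL] : (g^T <= laplacian)%MS.
  by exists w^T; rewrite -[g]trmxK wL trmx_mul laplacian_sym.
rewrite submxE; apply/eqP/matrixP => i j; rewrite [RHS]mxE.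
set w := col j (cokermx laplacian).
have Lw : laplacian *m w = 0 by rewrite /w colE mulmxA mulmx_coker mul0mx.
have -> : (g^T *m cokermx laplacian) i j = \sum_x g x 0 * w x 0.
  by rewrite mxE; apply: eq_bigr => x _; rewrite (ord1 i) !mxE.
case: (pickP 'I_N) => [x0 _|no]; last by rewrite big1 // => x; have := no x.
rewrite (eq_bigr (fun x => g x 0 * w x0 0)) => [|x _]; last first.
  by rewrite (laplacian_ker x x0 Lw).
by rewrite -mulr_suml g0 mul0r.
Qed.

End Laplacian.

(** * Scalar estimates *)

Section Young.
Context {R : realType}.

Lemma young (c u v : R) : 0 < c -> u * v <= c * u ^+ 2 + v ^+ 2 / (4 * c).
Proof.
move=> c0; rewrite -subr_ge0.
have -> : c * u ^+ 2 + v ^+ 2 / (4 * c) - u * v = c * (u - v / (2 * c)) ^+ 2.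
  by field; rewrite gt_eqF.
by rewrite mulr_ge0 ?sqr_ge0 // ltW.
Qed.

(** The value that [2 / eps] has to reach: the total coefficient of [|xi_i|^2]
    produced when the cross terms of the Lyapunov rate are split by Young's
    inequality.  [C] bounds the squared norm of the Laplacian, [B] those of the
    matrices [P_i], and [d] is the weight of the cross term. *)
Definition fast_gain (l lb d C B : R) : R :=
  lb ^+ 2 / l + 2 * d * C + B * (4 * lb ^+ 2 / l + 4 / d).

(** The contribution of one agent to the Lyapunov rate.  Here [q] is the output
    error, [s] the tracking error (so that [q - s] is the reference error), [g]
    the gradient gap, [z] the coordinate of [L eta], [w] that of [P xi] and [X]
    is [|xi|^2].  Of the [- l q^2] coming from [- q g], the terms [g s] and
    [g w] take a quarter each, the terms [g z] and [C (q - s)^2] an eighth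
    each; of [- d z^2] the terms [g z] and [z w] take a quarter each.  The
    weights in Young's inequality are the ones that achieve this. *)
Lemma agent_dissipation (l lb d C B K q s g z w X : R) :
  0 < l -> 0 < lb -> 0 < d -> 0 <= C -> 0 <= B ->
  d * (8 * lb ^+ 2 / l) <= 1 -> d * (16 * C / l) <= 1 ->
  g ^+ 2 <= lb ^+ 2 * q ^+ 2 -> l * q ^+ 2 <= q * g ->
  s ^+ 2 <= X -> w ^+ 2 <= B * X -> fast_gain l lb d C B <= K ->
  - ((q - s) * g) + d * (- ((g + z) * z) + C * (q - s) ^+ 2)
    + (- K * X + 2 * (g + z) * w) <= - (l / 4 * q ^+ 2).
Proof.
move=> l0 lb0 d0 C0 B0 d1 d2 gq qg sX wX HK.
have dlb : d * lb ^+ 2 <= l / 8.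
  move: d1; rewrite mulrA ler_pdivrMr // mul1r; lra.
have dC : d * C <= l / 16.
  move: d2; rewrite mulrA ler_pdivrMr // mul1r; lra.
have X0 : 0 <= X by apply: le_trans sX; exact: sqr_ge0.
have lb2 : 0 < lb ^+ 2 by rewrite exprn_gt0.
have q2 := sqr_ge0 q.
pose al := l / (4 * lb ^+ 2).
have al0 : 0 < al by rewrite divr_gt0 // mulr_gt0.
have alg : al * g ^+ 2 <= l / 4 * q ^+ 2.
  apply: le_trans (ler_wpM2l (ltW al0) gq) _.
  have -> : al * (lb ^+ 2 * q ^+ 2) = l / 4 * q ^+ 2.
    by rewrite /al; field; rewrite !gt_eqF.
  exact: lexx.
have t1 : g * s <= l / 4 * q ^+ 2 + lb ^+ 2 / l * X.
  apply: le_trans (young g s al0) _; apply: lerD => //.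
  have -> : s ^+ 2 / (4 * al) = lb ^+ 2 / l * s ^+ 2.
    by rewrite /al; field; rewrite !gt_eqF.
  by rewrite ler_wpM2l // divr_ge0 // ltW.
have t2 : - (d * (g * z)) <= l / 8 * q ^+ 2 + d / 4 * z ^+ 2.
  have y := young g (- z) (ltr01 : 0 < (1 : R)).
  have dg : d * g ^+ 2 <= l / 8 * q ^+ 2.
    apply: le_trans (ler_wpM2l (ltW d0) gq) _.
    by rewrite mulrA ler_wpM2r.
  have := ler_wpM2l (ltW d0) y; nra.
have t3 : d * (C * (q - s) ^+ 2) <= l / 8 * q ^+ 2 + 2 * d * C * X.
  have h : (q - s) ^+ 2 <= 2 * q ^+ 2 + 2 * X.
    by have := sqr_ge0 (q + s); nra.
  have dC0 : 0 <= d * C by rewrite mulr_ge0 // ltW.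
  have := ler_wpM2l dC0 h.
  have := ler_wpM2r q2 dC; nra.
have t4 : 2 * g * w <= l / 4 * q ^+ 2 + B * (4 * lb ^+ 2 / l) * X.
  have := young g (2 * w) al0.
  have -> : (2 * w) ^+ 2 / (4 * al) = 4 * lb ^+ 2 / l * w ^+ 2.
    by rewrite /al; field; rewrite !gt_eqF.
  have c0 : 0 <= 4 * lb ^+ 2 / l by rewrite divr_ge0 ?mulr_ge0 // ltW.
  have := ler_wpM2l c0 wX; nra.
have t5 : 2 * z * w <= d / 4 * z ^+ 2 + B * (4 / d) * X.
  have d4 : 0 < d / 4 by rewrite divr_gt0.
  have := young z (2 * w) d4.
  have -> : (2 * w) ^+ 2 / (4 * (d / 4)) = 4 / d * w ^+ 2.
    by field; rewrite gt_eqF.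
  have c0 : 0 <= 4 / d by rewrite divr_ge0 // ltW.
  have := ler_wpM2l c0 wX; nra.
have dz : 0 <= d * z ^+ 2 by rewrite mulr_ge0 ?sqr_ge0 // ltW.
have := ler_wpM2r X0 HK; rewrite /fast_gain => tK.
lra.
Qed.

(** The first two bounds make the Lyapunov function positive definite, the
    other two make its rate negative. *)
Lemma small_coupling (l lb C : R) : 0 < l -> 0 <= C ->
  exists2 d : R, 0 < d & [/\ d <= 1 / 2, d * C <= 1 / 2,
    d * (8 * lb ^+ 2 / l) <= 1 & d * (16 * C / l) <= 1].
Proof.
(* [S] dominates each of the factors that multiply [d]. *)
move=> l0 C0; pose S := 2 + 2 * C + 8 * lb ^+ 2 / l + 16 * C / l.
have p1 : 0 <= 8 * lb ^+ 2 / l.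
  by rewrite divr_ge0 ?(ltW l0) // mulr_ge0 // sqr_ge0.
have p2 : 0 <= 16 * C / l by rewrite divr_ge0 ?(ltW l0) // mulr_ge0.
have S0 : 0 < S by rewrite /S; lra.
have SV c : c <= S -> S^-1 * c <= 1 by move=> cS; rewrite ler_pdivrMl // mulr1.
exists S^-1; rewrite ?invr_gt0 //; split.
- have : S^-1 * 2 <= 1 by apply: SV; rewrite /S; lra.
  lra.
- have : S^-1 * (2 * C) <= 1 by apply: SV; rewrite /S; lra.
  lra.
- by apply: SV; rewrite /S; lra.
- by apply: SV; rewrite /S; lra.
Qed.

End Young.

(** * Boundedness and convergence of signals *)

Section Barbalat.
Context {R : realType}.

Lemma ode_on_decay (T : \bar R) (z dz : R -> R^o) (c s t : R) :
  ode_on T z dz -> 0 <= s -> s <= t -> (t%:E < T)%E ->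
  (forall u, 0 < u -> s <= u <= t -> dz u <= - c) -> z t <= z s - c * (t - s).
Proof.
move=> zP s0 st tT dzc.
have [u [su [u0|->]] e] := ode_on_MVT zP s0 st tT; last first.
  by rewrite !subrr mulr0 subr0.
have ts : 0 <= t - s by rewrite subr_ge0.
have := ler_wpM2r ts (dzc u u0 su); rewrite -e; lra.
Qed.

Lemma ode_on_lipschitz (T : \bar R) (z dz : R -> R^o) (D s t : R) :
  ode_on T z dz -> 0 <= s -> s <= t -> (t%:E < T)%E ->
  (forall u, 0 < u -> (u%:E < T)%E -> `|dz u| <= D) ->
  `|z t - z s| <= D * (t - s).
Proof.
move=> zP s0 st tT dzD.
have [u [su [u0|->]] e] := ode_on_MVT zP s0 st tT; last first.
  by rewrite !subrr mulr0 normr0.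
have ts : 0 <= t - s by rewrite subr_ge0.
rewrite e normrM (ger0_norm ts) ler_wpM2r // dzD //.
by apply: le_lt_trans tT; rewrite lee_fin; case/andP: su.
Qed.

(** A direct form of Barbalat's lemma.  If [|q t| >= eps] then [|q|] is at
    least [eps / 2] on an interval of fixed length [h] after [t], during which
    [U] loses the fixed amount [gap]; this is impossible once [U] is within
    [gap] of its infimum. *)
Lemma dissipation_vanishes (U dU q dq : R -> R^o) (c D : R) :
  ode_on +oo%E U dU -> ode_on +oo%E q dq ->
  (forall t, 0 <= t -> 0 <= U t) -> 0 < c ->
  (forall t, 0 < t -> dU t <= - (c * q t ^+ 2)) ->
  (forall t, 0 < t -> `|dq t| <= D) ->
  `|q t| @[t --> +oo] --> (0 : R).
Proof.
move=> UP qP U0 c0 dUq dqD.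
(* A Lipschitz constant that is positive even if [D] is not. *)
pose D' := `|D| + 1.
have D'0 : 0 < D' by rewrite ltr_wpDl.
have dqD' t : 0 < t -> `|dq t| <= D'.
  by move=> /dqD h; apply: le_trans h _; rewrite (le_trans (ler_norm D)) // lerDl.
have decr s t : 0 <= s -> s <= t -> U t <= U s.
  move=> s0 st; have := ode_on_decay (c := 0) UP s0 st (ltry _).
  rewrite mul0r subr0; apply=> u u0 _; rewrite oppr0 (le_trans (dUq u u0)) //.
  by rewrite oppr_le0 mulr_ge0 ?sqr_ge0 // ltW.
apply/cvgrPdist_lt => eps eps0.
pose h := eps / (2 * D').
have h0 : 0 < h by rewrite divr_gt0 // mulr_gt0.
pose gap := c * (eps / 2) ^+ 2 * h.
have gap0 : 0 < gap by rewrite mulr_gt0 // mulr_gt0 // exprn_gt0 // divr_gt0.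
pose A := [set U t | t in [set t | 0 <= t]].
have hA : has_inf A.
  split; first by exists (U 0), 0 => /=.
  by exists 0 => _ [t t0 <-]; exact: U0.
have [_ [t0 /= t00 <-] Ut0] := inf_adherent gap0 hA.
exists t0; split=> [|t t0t]; first exact: num_real.
rewrite sub0r normrN normr_id ltNge; apply/negP => qt.
have t_ge0 : 0 <= t by rewrite ltW // (le_lt_trans t00).
have Uth : U (t + h) <= U t - gap.
  have -> : gap = c * (eps / 2) ^+ 2 * (t + h - t).
    by rewrite /gap addrC addrA addNr add0r.
  have th : t <= t + h by rewrite lerDl ltW.
  apply: (ode_on_decay UP t_ge0 th (ltry _)) => u u0 /andP[tu uh].
  apply: le_trans (dUq u u0) _; rewrite lerN2 ler_wpM2l // ?(ltW c0) //.
  have lip := ode_on_lipschitz qP t_ge0 tu (ltry _) (fun s s0 _ => dqD' s s0).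
  have uth : D' * (u - t) <= eps / 2.
    have -> : eps / 2 = D' * h by rewrite /h; field; rewrite gt_eqF.
    by rewrite ler_pM2l // lerBlDl.
  have qu : eps / 2 <= `|q u|.
    have := ler_normB (q u) (q u - q t); rewrite subKr => tri.
    have := le_trans lip uth; lra.
  rewrite -[q u ^+ 2]real_normK ?num_real //.
  by rewrite lerXn2r // nnegrE ?normr_ge0 // divr_ge0 // ltW.
have infU : inf A <= U (t + h).
  by apply: (ge_inf hA.2); exists (t + h) => //=; rewrite addr_ge0 // ltW.
have := decr t0 t t00 (ltW t0t); lra.
Qed.

End Barbalat.

Section Boundedness.
Context {R : realType} (T : \bar R).

Definition bounded_until (z : R -> R) : Prop :=
  exists M, forall t, 0 <= t -> (t%:E < T)%E -> `|z t| <= M.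

Lemma bounded_until_cst c : bounded_until (fun=> c).
Proof. by exists `|c|. Qed.

Lemma bounded_untilD z w : bounded_until z -> bounded_until w ->
  bounded_until (fun t => z t + w t).
Proof.
move=> [M zM] [K wK]; exists (M + K) => t t0 tT.
by rewrite (le_trans (ler_normD _ _)) // lerD ?zM ?wK.
Qed.

Lemma bounded_untilM z w : bounded_until z -> bounded_until w ->
  bounded_until (fun t => z t * w t).
Proof.
move=> [M zM] [K wK]; exists (M * K) => t t0 tT.
by rewrite normrM ler_pM ?zM ?wK.
Qed.

Lemma bounded_until_sum (I : Type) (s : seq I) (Q : pred I) (z : I -> R -> R) :
  (forall i, bounded_until (z i)) ->
  bounded_until (fun t => \sum_(i <- s | Q i) z i t).
Proof.
move=> zP; elim: s => [|i s [M sM]].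
  by exists 0 => t *; rewrite big_nil normr0.
have [K zK] := zP i; exists (`|K| + M) => t t0 tT; rewrite big_cons.
case: (Q i); last by rewrite (le_trans (sM t t0 tT)) // lerDr.
rewrite (le_trans (ler_normD _ _)) // lerD ?sM //.
by rewrite (le_trans (zK t t0 tT)) // ler_norm.
Qed.

Lemma bounded_until_sqr z M :
  (forall t, 0 <= t -> (t%:E < T)%E -> z t ^+ 2 <= M) -> bounded_until z.
Proof.
move=> zM; exists (Num.sqrt M) => t t0 tT.
by rewrite -sqrtr_sqr ler_wsqrtr // zM.
Qed.

Lemma bounded_until_ext z w : z =1 w -> bounded_until z -> bounded_until w.
Proof. by move=> /funext <-. Qed.

(** The box is compact as a product of segments.  The transpositions are there
    because compactness is used for row vectors. *)
Lemma continuous_bounded_above_box n (f : 'cV[R]_n -> R) (M : R) :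
  continuous f ->
  exists K, forall v : 'cV[R]_n, (forall j, `|v j 0| <= M) -> f v <= K.
Proof.
move=> cf.
pose box := [set v : 'rV[R]_n | forall i, [set` `[- `|M|, `|M|]] (v ord0 i)].
have cbox : compact box.
  by apply: (@rV_compact _ _ (fun=> `[- `|M|, `|M|]%classic)) => i;
    exact: segment_compact.
have ctr : continuous (fun v : 'rV[R]_n => v^T).
  move=> v s /nbhs_ballP [e e0 es]; apply/nbhs_ballP; exists e => // w [_ vw].
  by apply: es; split=> // i j; rewrite !mxE; exact: vw.
have [||c _ cmax] := @EVT_max_rV R n (fun v => f v^T) box _ cbox.
- by exists 0 => i /=; rewrite mxE in_itv /= oppr_le0 normr_ge0.
- apply: continuous_subspaceT => v; apply: continuous_comp; [exact: ctr|exact: cf].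
exists (f c^T) => v vM; rewrite -[v]trmxK; apply: cmax.
rewrite inE => i /=; rewrite mxE in_itv /= -ler_norml.
exact: le_trans (vM i) (ler_norm M).
Qed.

End Boundedness.

(** * One agent in scaled coordinates *)

Section Agent.
Context {R : realType} (n m : nat) (hn : (0 < n)%N).
Variables (p : 'cV[R]_n -> R -> 'cV[R]_m) (k : 'I_n -> R) (eps : R).
Variables (theta : 'cV[R]_m) (T : \bar R).
Variables (x : R -> 'cV[R]_n) (th : R -> 'cV[R]_m) (r dr : R -> R).
Hypothesis eps_gt0 : 0 < eps.
Hypothesis xP : agent_solution p theta T
  (fun t => control_input hn k eps (p (x t) t) (th t) (r t) (x t)) x.
Hypothesis rP : ode_on T (r : R -> R^o) dr.

Local Notation xi t := (scaled_state eps (r t) (x t)).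
Local Notation mismatch t := (theta - th t).

Lemma scaled_stateE t j :
  xi t j 0 = eps ^+ j * x t j 0 - (j == Ordinal hn)%:R * r t.
Proof.
rewrite mxE -val_eqE /=; case: eqP => [->|_]; first by rewrite expr0 !mul1r.
by rewrite mul0r subr0.
Qed.

(** The right-hand side in the scaled coordinates: the gains make the fast part
    the companion matrix, and the scaling turns the unknown term into a
    multiple of [eps ^+ n.-1] in the last coordinate. *)
Definition scaled_field (t : R) : 'cV[R]_n :=
  eps^-1 *: (companion_mx k *m xi t)
  + (eps ^+ n.-1 * dot (mismatch t) (p (x t) t)) *: b2 R n
  - dr t *: delta_mx (Ordinal hn) 0.

(** The inner equations and the last one are first given the common form [D],
    the unscaled derivative of the [j]-th coordinate. *)
Lemma ode_on_scaled_state j :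
  ode_on T (fun t => xi t j 0 : R^o) (fun t => scaled_field t j 0).
Proof.
pose D t := (eps ^+ j)^-1 * (eps^-1 * (companion_mx k *m xi t) j 0
  + eps ^+ n.-1 * dot (mismatch t) (p (x t) t) * b2 R n j 0).
have e0 : eps != 0 by rewrite gt_eqF.
have xD : ode_on T (fun t => x t j 0 : R^o) D.
  case: xP => inner last; have [jn|jn] := eqVneq j.+1 n.
    apply: ode_on_ext (last j jn) => // t _ _.
    rewrite /D [b2 _ _ _ _]mxE jn eqxx mulr1 [(_ *m _) j 0]mxE.
    rewrite (eq_bigr (fun i => k i * xi t i 0)); last first.
      by move=> i _; rewrite mxE jn eqxx.
    rewrite (bigD1 (Ordinal hn)) //= /control_input.
    have -> : n.-1 = j by exact: (congr1 predn (esym jn)).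
    have -> : eps ^+ n = eps * eps ^+ j.
      by rewrite -exprS; congr (_ ^+ _); exact: esym.
    have -> : \sum_(i < n | i != Ordinal hn) k i * xi t i 0 =
              \sum_(i < n | (0 < i)%N) eps ^+ i * k i * x t i 0.
      apply: eq_big => [i|i i0]; first by rewrite lt0n.
      by rewrite scaled_stateE (negbTE i0) mul0r subr0 mulrCA mulrA.
    rewrite scaled_stateE eqxx expr0 !mul1r -/(dot _ _) -/(dot _ _) dotDl dotNl.
    by field; rewrite expf_neq0 // e0.
  have j1n : (j.+1 < n)%N by rewrite ltn_neqAle jn ltn_ord.
  apply: ode_on_ext (inner j (Ordinal j1n) erefl) => // t _ _.
  rewrite /D [(_ *m _) j 0]mxE [b2 _ _ _ _]mxE (negbTE jn) mulr0 addr0.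
  rewrite (bigD1 (Ordinal j1n)) //= big1 ?addr0 => [|i ij]; last first.
    by rewrite mxE (negbTE jn) -[_ == j.+1]/(i == Ordinal j1n) (negbTE ij) mul0r.
  rewrite mxE (negbTE jn) eqxx mul1r scaled_stateE /= mul0r subr0 exprS.
  by field; rewrite expf_neq0 // e0.
have := ode_onD (ode_onZ (eps ^+ j) xD) (ode_onZ (- (j == Ordinal hn)%:R) rP).
apply: ode_on_ext => [t|t _ _]; first by rewrite scaled_stateE mulNr.
rewrite /D /scaled_field !mxE eqxx andbT mulVKf ?expf_neq0 //; ring.
Qed.

Variable P : 'M[R]_n.
Hypothesis PP : lyapunov_solution k P.
Hypothesis thP : ode_on T th
  (fun t => ((b2 R n)^T *m P *m xi t) 0 0 *: p (x t) t).

(** The weight [eps ^+ n.-1] is the one that lets the update law cancel the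
    parameter mismatch. *)
Definition storage (t : R) : R :=
  dot (xi t) (P *m xi t) + eps ^+ n.-1 * dot (mismatch t) (mismatch t).

Lemma ode_on_mismatch j : ode_on T (fun t => mismatch t j 0 : R^o)
  (fun t => (- (dot (b2 R n) (P *m xi t) *: p (x t) t)) j 0).
Proof.
have := ode_onD (ode_on_cst T (theta j 0)) (ode_onZ (-1) (ode_on_coord j thP)).
by apply: ode_on_ext => [t|t _ _]; rewrite /dot ?mulmxA !mxE ?add0r mulN1r.
Qed.

(** The Lyapunov equation gives the quadratic term; the term
    [dot (mismatch t) (p (x t) t) * dot (b2 R n) (P *m xi t)] comes from both
    summands of the storage, with opposite signs. *)
Lemma ode_on_storage : ode_on T (storage : R -> R^o)
  (fun t => - (2 / eps) * dot (xi t) (xi t)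
            - 2 * dr t * (P *m xi t) (Ordinal hn) 0).
Proof.
have [[Ps _] AP] := PP.
have := ode_onD (ode_on_dot ode_on_scaled_state (ode_on_mulmx P ode_on_scaled_state))
  (ode_onZ (eps ^+ n.-1) (ode_on_dot ode_on_mismatch ode_on_mismatch)).
apply: ode_on_ext => // t _ _.
set v := xi t; set w := p (x t) t; set z := mismatch t.
have lyap : dot (companion_mx k *m v) (P *m v) = - dot v v.
  have : dot v (((companion_mx k)^T *m P + P *m companion_mx k) *m v)
         = - 2 * dot v v.
    by rewrite AP -scalemxAl mul1mx dotZr.
  rewrite mulmxDl dotDr -!mulmxA dot_mulmx trmxK [dot v (P *m _)]dot_mulmx Ps.
  by rewrite [dot (P *m v) _]dotC; lra.
have sw : dot v (P *m scaled_field t) = dot (scaled_field t) (P *m v).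
  by rewrite dot_mulmx Ps dotC.
rewrite sw [dot z (- _)]dotC /scaled_field -/v -/w -/z; clearbody z.
rewrite !(dotDl, dotZl, dotNl) lyap dot_delta [dot w z]dotC.
field; by rewrite gt_eqF.
Qed.

End Agent.

(** * The closed loop *)

Section ClosedLoop.
Context {R : realType} (N : nat) (n m : 'I_N -> nat).
Unset Implicit Arguments.
Variables (hn : forall i, (0 < n i)%N).
Variables (p : forall i, 'cV[R]_(n i) -> R -> 'cV[R]_(m i)).
Variables (rho : forall i, 'cV[R]_(n i) -> R).
Variables (f : 'I_N -> R -> R) (l lbar : R) (a : 'M[R]_N) (ystar : R).
Variables (k : forall i, 'I_(n i) -> R) (P : forall i, 'M[R]_(n i)).
Variables (theta : forall i, 'cV[R]_(m i)) (eps : R) (T : \bar R).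
Variables (x : forall i, R -> 'cV[R]_(n i)) (th : forall i, R -> 'cV[R]_(m i)).
Variables (r lam : 'I_N -> R -> R) (lamstar : 'cV[R]_N).

Set Implicit Arguments.
Hypothesis l_gt0 : 0 < l.
Hypothesis lbar_gt0 : 0 < lbar.
Hypothesis fP : forall i u v, l * (u - v) ^+ 2 <=
  (u - v) * (derive1 (f i) u - derive1 (f i) v).
Hypothesis flip : forall i u v,
  (derive1 (f i) u - derive1 (f i) v) ^+ 2 <= lbar ^+ 2 * (u - v) ^+ 2.
Hypothesis ha : weighted_graph a.
Hypothesis lamstarP : forall i,
  (laplacian a *m lamstar) i 0 = - derive1 (f i) ystar.
Hypothesis hP : forall i, lyapunov_solution (k i) (P i).
Hypothesis eps_gt0 : 0 < eps.
Hypothesis sol : closed_loop_solution hn p f a k P theta eps T x th r lam.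

Local Notation L := (laplacian a).

Definition primal_error (t : R) : 'cV[R]_N := \col_i (r i t - ystar).
Definition dual_error (t : R) : 'cV[R]_N := \col_i (lam i t - lamstar i 0).
Definition gradient_gap (t : R) : 'cV[R]_N :=
  \col_i (derive1 (f i) (output (hn i) (x i t)) - derive1 (f i) ystar).

Local Notation e := primal_error.
Local Notation eta := dual_error.
Local Notation g := gradient_gap.
Local Notation xi i t := (scaled_state eps (r i t) (x i t)).

(** The gradients at [ystar] are absorbed by shifting the multipliers by
    [lamstar]. *)
Lemma ode_on_primal_error i : ode_on T (fun t => e t i 0 : R^o)
  (fun t => (- (g t + L *m eta t)) i 0).
Proof.
have [_ _ rP _] := sol i.
have := ode_onD rP (ode_on_cst T (- ystar)).
apply: ode_on_ext => [t|t _ _]; first by rewrite mxE.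
rewrite addr0 [RHS]mxE [(_ + _ : 'cV_N) i 0]mxE [g t i 0]mxE.
have -> : eta t = (\col_i lam i t) - lamstar.
  by apply/matrixP => j c; rewrite (ord1 c) !mxE.
rewrite mulmxBr [(_ - _ : 'cV_N) i 0]mxE [(- _ : 'cV_N) i 0]mxE lamstarP.
have -> : (L *m (\col_j lam j t)) i 0 = \sum_j a i j * (lam i t - lam j t).
  by rewrite laplacian_mulE; apply: eq_bigr => j _; rewrite !mxE.
ring.
Qed.

Lemma ode_on_dual_error i : ode_on T (fun t => eta t i 0 : R^o)
  (fun t => (L *m e t) i 0).
Proof.
have [_ _ _ lP] := sol i.
have := ode_onD lP (ode_on_cst T (- lamstar i 0)).
apply: ode_on_ext => [t|t _ _]; first by rewrite mxE.
rewrite addr0 laplacian_mulE; apply: eq_bigr => j _; rewrite !mxE; ring.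
Qed.

Lemma ode_on_reference i : ode_on T (r i : R -> R^o)
  (fun t => (- (g t + L *m eta t)) i 0).
Proof.
have := ode_onD (ode_on_primal_error i) (ode_on_cst T ystar).
by apply: ode_on_ext => [t|t _ _]; rewrite ?addr0 // mxE subrK.
Qed.

Definition lyapunov (d t : R) : R :=
  1 / 2 * dot (e t) (e t) + 1 / 2 * dot (eta t) (eta t)
  + d * dot (e t) (L *m eta t)
  + \sum_i storage eps (theta i) (x i) (th i) (r i) (P i) t.

Definition lyapunov_rate (d t : R) : R :=
  - dot (e t) (g t)
  + d * (- dot (g t + L *m eta t) (L *m eta t) + dot (L *m e t) (L *m e t))
  + \sum_i (- (2 / eps) * dot (xi i t) (xi i t)
            + 2 * (g t + L *m eta t) i 0 * (P i *m xi i t) (Ordinal (hn i)) 0).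

(** As [L] is symmetric, the terms [e . L eta] coming from [|e|^2] and
    [|eta|^2] cancel, and the derivative of the cross term yields
    [- |L eta|^2] at the cost of [|L e|^2]. *)
Lemma ode_on_lyapunov d :
  ode_on T (lyapunov d : R -> R^o) (lyapunov_rate d).
Proof.
have eD := ode_on_primal_error; have nD := ode_on_dual_error.
have sD i := let: And4 xP thP _ _ := sol i in
  ode_on_storage eps_gt0 xP (ode_on_reference i) (hP i) thP.
have := ode_onD (ode_onD (ode_onD (ode_onZ (1 / 2) (ode_on_dot eD eD))
  (ode_onZ (1 / 2) (ode_on_dot nD nD)))
  (ode_onZ d (ode_on_dot eD (ode_on_mulmx L nD))))
  (ode_on_sum (index_enum 'I_N) sD).
apply: ode_on_ext => // t _ _; rewrite /lyapunov_rate.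
set u := g t + _; set z := L *m eta t; set v := e t; set w := eta t.
have -> : dot (L *m v) w = dot v z by rewrite dot_mulmx laplacian_sym.
have -> : dot w (L *m v) = dot v z by rewrite dotC dot_mulmx laplacian_sym.
have -> : dot v (L *m (L *m v)) = dot (L *m v) (L *m v).
  by rewrite dot_mulmx laplacian_sym.
rewrite [dot (- u) v]dotC !dotNr !dotNl.
have -> : dot v u = dot v (g t) + dot v z by rewrite -dotDr.
congr (_ + _); first by field.
apply: eq_bigr => i _; rewrite [(- u) i 0]mxE; ring.
Qed.

Variables (d C B : R).
Hypothesis d_gt0 : 0 < d.
Hypothesis C_ge0 : 0 <= C.
Hypothesis B_ge0 : 0 <= B.
Hypothesis LC : forall v, dot (L *m v) (L *m v) <= C * dot v v.
Hypothesis PB : forall i v,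
  dot (P i *m v) (P i *m v) <= B * dot v v.
Hypothesis d_half : d <= 1 / 2.
Hypothesis dC_half : d * C <= 1 / 2.
Hypothesis dlbar : d * (8 * lbar ^+ 2 / l) <= 1.
Hypothesis dC_l : d * (16 * C / l) <= 1.
Hypothesis eps_small : fast_gain l lbar d C B <= 2 / eps.

(** After [|L e|^2] is bounded by [C |e|^2] the rate is a sum over the agents,
    to which [agent_dissipation] applies term by term. *)
Lemma lyapunov_rate_le t : lyapunov_rate d t <=
  - (l / 4 * \sum_i (output (hn i) (x i t) - ystar) ^+ 2).
Proof.
rewrite /lyapunov_rate.
set z := L *m eta t.
apply: (@le_trans _ _ (- dot (e t) (g t)
  + d * (- dot (g t + z) z + C * dot (e t) (e t)) +
  \sum_i (- (2 / eps) * dot (xi i t) (xi i t)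
            + 2 * (g t + z) i 0 * (P i *m xi i t) (Ordinal (hn i)) 0))).
  by rewrite lerD2r lerD2l ler_wpM2l ?(ltW d_gt0) // lerD2l.
rewrite (_ : - dot (e t) (g t) + _ = \sum_i (- (e t i 0 * g t i 0)
    + d * (- ((g t + z) i 0 * z i 0) + C * e t i 0 ^+ 2))); last first.
  by rewrite big_split -mulr_sumr big_split -mulr_sumr !sumrN sqr_dot !dotE.
rewrite -big_split mulr_sumr -sumrN ler_sum // => i _ /=.
have -> : e t i 0 = output (hn i) (x i t) - ystar - xi i t (Ordinal (hn i)) 0.
  by rewrite !mxE /output /=; ring.
rewrite [(g t + z : 'cV_N) i 0]mxE.
apply: agent_dissipation eps_small => //.
- by rewrite mxE.
- by rewrite mxE.
- exact: sqr_coord_le_dot.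
- by apply: le_trans (@PB i _); exact: sqr_coord_le_dot.
Qed.

(** The cross term is at least [- (d / 2) (|e|^2 + |L eta|^2)], and
    [d <= 1 / 2], [d C <= 1 / 2]. *)
Lemma lyapunov_ge t :
  1 / 4 * dot (e t) (e t) + 1 / 4 * dot (eta t) (eta t)
  + \sum_i storage eps (theta i) (x i) (th i) (r i) (P i) t <= lyapunov d t.
Proof.
rewrite /lyapunov lerD2r.
set z := L *m eta t.
have ez := dot_ge0 (e t + z).
rewrite !(dotDl, dotDr) [dot z (e t)]dotC in ez.
have zn : dot z z <= C * dot (eta t) (eta t) := LC _.
have e0 := dot_ge0 (e t); have n0 := dot_ge0 (eta t).
have := ler_wpM2l (ltW d_gt0) ez; have := ler_wpM2l (ltW d_gt0) zn.
have := ler_wpM2r e0 d_half; have := ler_wpM2r n0 dC_half.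
rewrite mulr0; nra.
Qed.

Lemma storage_ge0 i t :
  0 <= storage eps (theta i) (x i) (th i) (r i) (P i) t.
Proof.
rewrite addr_ge0 ?posdef_ge0 //; first by case: (hP i).
by rewrite mulr_ge0 ?dot_ge0 // exprn_ge0 // ltW.
Qed.

Lemma lyapunov_ge0 t : 0 <= lyapunov d t.
Proof.
apply: le_trans (lyapunov_ge t); rewrite addr_ge0 //.
  by rewrite addr_ge0 // mulr_ge0 ?dot_ge0.
by rewrite sumr_ge0 // => i _; exact: storage_ge0.
Qed.

Lemma lyapunov_rate_le0 t : lyapunov_rate d t <= 0.
Proof.
apply: le_trans (lyapunov_rate_le t) _.
rewrite oppr_le0 mulr_ge0 ?divr_ge0 ?(ltW l_gt0) // sumr_ge0 // => i _.
exact: sqr_ge0.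
Qed.

Lemma lyapunov_le_initial t : 0 <= t -> (t%:E < T)%E ->
  lyapunov d t <= lyapunov d 0.
Proof.
move=> t0 tT.
have := ode_on_decay (c := 0) (ode_on_lyapunov d) (lexx 0) t0 tT.
rewrite mul0r subr0; apply=> u _ _; rewrite oppr0; exact: lyapunov_rate_le0.
Qed.

Local Notation U0 := (lyapunov d 0).

Lemma lyapunov_terms_le t : 0 <= t -> (t%:E < T)%E ->
  [/\ dot (e t) (e t) <= 4 * U0, dot (eta t) (eta t) <= 4 * U0 &
    forall i, dot (xi i t) (P i *m xi i t) <= U0 /\
      eps ^+ (n i).-1 * dot (theta i - th i t) (theta i - th i t) <= U0].
Proof.
move=> t0 tT; have U := le_trans (lyapunov_ge t) (lyapunov_le_initial t0 tT).
have e0 := dot_ge0 (e t); have n0 := dot_ge0 (eta t).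
have S0 : 0 <= \sum_i storage eps (theta i) (x i) (th i) (r i) (P i) t.
  by rewrite sumr_ge0 // => i _; exact: storage_ge0.
split; [lra|lra|move=> i].
have Si : storage eps (theta i) (x i) (th i) (r i) (P i) t <= U0.
  have : storage eps (theta i) (x i) (th i) (r i) (P i) t <=
         \sum_i storage eps (theta i) (x i) (th i) (r i) (P i) t.
    by rewrite [leRHS](bigD1 i) //= lerDl sumr_ge0 // => j _; exact: storage_ge0.
  lra.
have V0 : 0 <= dot (xi i t) (P i *m xi i t).
  by apply: posdef_ge0; case: (hP i).
have m0 : 0 <= eps ^+ (n i).-1 * dot (theta i - th i t) (theta i - th i t).
  by rewrite mulr_ge0 ?dot_ge0 // exprn_ge0 // ltW.
by rewrite /storage in Si; split; lra.
Qed.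

Lemma bounded_primal_error i : bounded_until T (fun t => e t i 0).
Proof.
apply: (bounded_until_sqr (M := 4 * U0)) => t t0 tT.
apply: le_trans (sqr_coord_le_dot _ _) _; by case: (lyapunov_terms_le t0 tT).
Qed.

Lemma bounded_dual_error i : bounded_until T (fun t => eta t i 0).
Proof.
apply: (bounded_until_sqr (M := 4 * U0)) => t t0 tT.
apply: le_trans (sqr_coord_le_dot _ _) _; by case: (lyapunov_terms_le t0 tT).
Qed.

Lemma bounded_scaled_state i j : bounded_until T (fun t => xi i t j 0).
Proof.
have [Pp _] := hP i; have [c c0 cP] := posdef_coercive Pp.
apply: (bounded_until_sqr (M := c * U0)) => t t0 tT.
apply: le_trans (cP _ _) _; rewrite ler_wpM2l //.
by have [_ _ /(_ i) []] := lyapunov_terms_le t0 tT.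
Qed.

Lemma bounded_mismatch i j : bounded_until T (fun t => (theta i - th i t) j 0).
Proof.
have en : 0 < eps ^+ (n i).-1 by rewrite exprn_gt0.
apply: (bounded_until_sqr (M := (eps ^+ (n i).-1)^-1 * U0)) => t t0 tT.
apply: le_trans (sqr_coord_le_dot _ _) _; rewrite ler_pdivlMl //.
by have [_ _ /(_ i) []] := lyapunov_terms_le t0 tT.
Qed.

Lemma bounded_reference i : bounded_until T (r i).
Proof.
have := bounded_untilD (bounded_primal_error i) (bounded_until_cst T ystar).
by apply: bounded_until_ext => t; rewrite mxE subrK.
Qed.

Lemma bounded_state i j : bounded_until T (fun t => x i t j 0).
Proof.
have := bounded_untilM (bounded_until_cst T (eps ^+ j)^-1)
  (bounded_untilD (bounded_scaled_state j)
    (bounded_untilM (bounded_until_cst T (j == Ordinal (hn i))%:R)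
      (bounded_reference i))).
apply: bounded_until_ext => t; rewrite (scaled_stateE (hn i)) subrK mulKf //.
by rewrite expf_neq0 // gt_eqF.
Qed.

Lemma bounded_enorm i : bounded_until T (fun t => enorm (x i t)).
Proof.
have [M xM] := bounded_until_sum (index_enum 'I_(n i)) predT
  (fun j => bounded_untilM (bounded_state j) (bounded_state j)).
apply: (bounded_until_sqr (M := M)) => t t0 tT.
rewrite enormE sqr_sqrtr ?dot_ge0 // dotE.
by apply: le_trans (ler_norm _) _; exact: xM.
Qed.

Lemma bounded_gradient_gap i : bounded_until T (fun t => g t i 0).
Proof.
have [M yM] := bounded_untilD (bounded_state (Ordinal (hn i)))
  (bounded_until_cst T (- ystar)).
apply: (bounded_until_sqr (M := lbar ^+ 2 * M ^+ 2)) => t t0 tT.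
rewrite mxE; apply: le_trans (flip _ _ _) _.
rewrite ler_wpM2l ?sqr_ge0 // -[leLHS]real_normK ?num_real //.
have := yM t t0 tT => h; rewrite lerXn2r ?nnegrE ?normr_ge0 //.
exact: le_trans (normr_ge0 _) h.
Qed.

Lemma bounded_reference_rate i :
  bounded_until T (fun t => (- (g t + L *m eta t)) i 0).
Proof.
have := bounded_untilM (bounded_until_cst T (-1))
  (bounded_untilD (bounded_gradient_gap i)
    (bounded_until_sum (index_enum 'I_N) predT (fun j =>
      bounded_untilM (bounded_until_cst T (L i j)) (bounded_dual_error j)))).
apply: bounded_until_ext => t; rewrite mulN1r [RHS]mxE; congr (- _).
by rewrite [RHS]mxE [(L *m _) i 0]mxE.
Qed.

Hypothesis hrho : forall i, continuous (rho i).
Hypothesis hp : forall i (v : 'cV[R]_(n i)) (t : R), 0 <= t ->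
  enorm (p i v t) <= rho i v.

Lemma bounded_basis i j : bounded_until T (fun t => p i (x i t) t j 0).
Proof.
have [M xM] := bounded_enorm i.
have [K rK] := continuous_bounded_above_box M (@hrho i).
exists K => t t0 tT; apply: le_trans (rK (x i t) _) => [|j'].
  apply: le_trans (hp _ t0).
  by rewrite enormE -sqrtr_sqr ler_wsqrtr // sqr_coord_le_dot.
apply: le_trans (le_trans (ler_norm _) (xM t t0 tT)).
by rewrite enormE -sqrtr_sqr ler_wsqrtr // sqr_coord_le_dot.
Qed.

Lemma bounded_scaled_field i j : bounded_until T (fun t =>
  scaled_field (hn i) (p i) (k i) eps (theta i) (x i) (th i) (r i)
    (fun t => (- (g t + L *m eta t)) i 0) t j 0).
Proof.
have := bounded_untilD (bounded_untilD
  (bounded_untilM (bounded_until_cst T eps^-1)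
    (bounded_until_sum (index_enum 'I_(n i)) predT (fun j' =>
      bounded_untilM (bounded_until_cst T (companion_mx (k i) j j'))
        (bounded_scaled_state j'))))
  (bounded_untilM (bounded_untilM (bounded_until_cst T (eps ^+ (n i).-1))
    (bounded_until_sum (index_enum 'I_(m i)) predT (fun j' =>
      bounded_untilM (bounded_mismatch j') (bounded_basis j'))))
    (bounded_until_cst T (b2 R (n i) j 0))))
  (bounded_untilM (bounded_reference_rate i)
    (bounded_until_cst T (- (delta_mx (Ordinal (hn i)) 0 : 'cV[R]_(n i)) j 0))).
apply: bounded_until_ext => t; rewrite /scaled_field.
set dr := (- (g t + _)) i 0.
rewrite [RHS]mxE [in RHS]mxE [X in _ = X + _ + _]mxE [X in _ = _ + X + _]mxE.
rewrite [X in _ = _ + X]mxE [X in _ = _ + _ - X]mxE [(companion_mx _ *m _) _ _]mxE.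
by rewrite dotE mulrN.
Qed.

(** [bounded_basis] is what makes the output Lipschitz when the agent has
    order 1, where the input acts on the output directly. *)
Lemma output_converges i : T = +oo%E ->
  `|output (hn i) (x i t) - ystar| @[t --> +oo] --> (0 : R).
Proof.
move=> Too.
have [D qD] := bounded_untilD (bounded_reference_rate i)
  (bounded_scaled_field (Ordinal (hn i))).
have [xP _ _ _] := sol i.
have UP := ode_on_lyapunov d.
have qP := ode_onD (ode_on_primal_error i)
  (ode_on_scaled_state eps_gt0 xP (ode_on_reference i) (Ordinal (hn i))).
have qE t : e t i 0 + xi i t (Ordinal (hn i)) 0 = output (hn i) (x i t) - ystar.
  by rewrite !mxE /output /=; ring.
have {}qP : ode_on T (fun t => output (hn i) (x i t) - ystar : R^o) _ :=
  ode_on_ext qE (fun t _ _ => erefl) qP.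
rewrite Too in UP qP qD.
apply: (dissipation_vanishes (c := l / 4) UP qP) => [t _||t t0|t t0].
- exact: lyapunov_ge0.
- by rewrite (divr_gt0 l_gt0).
- apply: le_trans (lyapunov_rate_le t) _; rewrite lerN2 ler_wpM2l //.
    by rewrite divr_ge0 // ltW.
  by rewrite [leRHS](bigD1 i) //= lerDl sumr_ge0 // => j _; exact: sqr_ge0.
- by apply: qD; rewrite ?ltW // ltry.
Qed.

End ClosedLoop.

(** * Convergence of the controller *)

Unset Implicit Arguments.

Theorem theorem1 (R : realType) (N : nat) (n m : 'I_N -> nat)
  (hn : forall i, (0 < n i)%N)
  (p : forall i, 'cV[R]_(n i) -> R -> 'cV[R]_(m i))
  (rho : forall i, 'cV[R]_(n i) -> R)
  (f : 'I_N -> R -> R) (l lbar : R) (a : 'M[R]_N) (ystar : R)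
  (k : forall i, 'I_(n i) -> R) (P : forall i, 'M[R]_(n i))
  (hrho : forall i, smooth (rho i))
  (hp : forall i (x : 'cV[R]_(n i)) (t : R), 0 <= t ->
     enorm (p i x t) <= rho i x)
  (hl : 0 < l) (hlbar : 0 < lbar)
  (hfd : forall i (y : R), derivable (f i) y 1)
  (hfc : forall i, strongly_convex l (f i))
  (hfl : forall i, lbar.-lipschitz (derive1 (f i) : R^o -> R^o))
  (ha : weighted_graph a) (hconn : graph_connected a)
  (hystar : is_argmin (fun y => \sum_(i < N) f i y) ystar)
  (hk : forall i, hurwitz (gain_poly (k i)))
  (hP : forall i, lyapunov_solution (k i) (P i)) :
  exists2 epsstar : R, 0 < epsstar &
    forall (theta : forall i, 'cV[R]_(m i)) (eps : R),
    0 < eps < epsstar ->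
    forall (T : \bar R) (x : forall i, R -> 'cV[R]_(n i))
      (th : forall i, R -> 'cV[R]_(m i)) (r lam : 'I_N -> R -> R),
    (0 < T)%E ->
    closed_loop_solution hn p f a k P theta eps T x th r lam ->
    (forall i, exists M : R, forall t : R, 0 <= t -> (t%:E < T)%E ->
       enorm (x i t) <= M) /\
    (T = +oo%E ->
     forall i, `|output (hn i) (x i t) - ystar| @[t --> +oo] --> (0 : R)).

Proof.
have mono i u v := strongly_convex_monotone (hfd i u) (hfd i v) (hfc i).
have lip i u v : (derive1 (f i) u - derive1 (f i) v) ^+ 2 <=
    lbar ^+ 2 * (u - v) ^+ 2.
  rewrite -exprMn -[leLHS]real_normK ?num_real //.
  rewrite -[leRHS]real_normK ?num_real // lerXn2r ?nnegrE ?normr_ge0 //.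
  by rewrite normrM (gtr0_norm hlbar); exact: (hfl i (u, v)).
have [lamstar lamP] : exists v : 'cV[R]_N,
    laplacian a *m v = \col_i - derive1 (f i) ystar.
  apply: laplacian_range => //.
  under eq_bigr do rewrite mxE.
  by rewrite sumrN (sum_derive_argmin hfd hystar) oppr0.
have lamE i : (laplacian a *m lamstar) i 0 = - derive1 (f i) ystar.
  by rewrite lamP mxE.
have [C C0 LC] := mulmx_bounded (laplacian a).
have /boolp.choice [b bP] : forall i, exists b : R, 0 <= b /\
    forall v, dot (P i *m v) (P i *m v) <= b * dot v v.
  by move=> i; have [c c0 cP] := mulmx_bounded (P i); exists c.
pose B := \sum_i b i.
have B0 : 0 <= B by rewrite sumr_ge0 // => i _; case: (bP i).
have PB i v : dot (P i *m v) (P i *m v) <= B * dot v v.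
  apply: le_trans ((bP i).2 v) _; rewrite ler_wpM2r ?dot_ge0 //.
  by rewrite /B (bigD1 i) //= lerDl sumr_ge0 // => j _; case: (bP j).
have [d d0 [d1 d2 d3 d4]] := small_coupling lbar hl C0.
pose K := `|fast_gain l lbar d C B| + 1.
have K0 : 0 < K by rewrite ltr_wpDl.
exists (2 / K) => [|theta eps /andP[eps0 epsK] T x th r lam _ sol].
  by rewrite divr_gt0.
have epsP : fast_gain l lbar d C B <= 2 / eps.
  rewrite ler_pdivlMr //; move: epsK; rewrite ltr_pdivlMr // mulrC => /ltW.
  apply: le_trans; rewrite ler_wpM2r ?(ltW eps0) //.
  by rewrite (le_trans (ler_norm _)) // lerDl.
have crho i : continuous (rho i) by case: (hrho i [::]).
split=> [i|Too i].
  have [M xM] := bounded_enorm hl hlbar mono lip ha lamE hP eps0 sol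
    d0 C0 B0 LC PB d1 d2 d3 d4 epsP i.
  by exists M => t t0 tT; apply: le_trans (xM t t0 tT); exact: ler_norm.
exact: (output_converges hl hlbar mono lip ha lamE hP eps0 sol
  d0 C0 B0 LC PB d1 d2 d3 d4 epsP crho hp).
Qed.
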